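(* Let $\mathcal G$ be a connected compact metric graph with total length $|\mathcal G|=L$, let $\mathcal V^D\subseteq\mathcal V$ be a nonempty set of degree-one vertices, let $1<p<\infty$ and $q=p/(p-1)$. Then the $p$-torsional rigidity satisfies $$T_p(\mathcal G,\mathcal V^D)\le\Bigl(\frac{L^{q+1}}{q+1}\Bigr)^{p-1}=T_p([0,L],\{L\}),$$ where $[0,L]$ is the interval of length $L$ regarded as a metric graph with one edge and vertices $0,L$, with Dirichlet set $\{L\}$. Equality holds in the inequality if and only if $\mathcal G$ is an interval of length $L$ with a single Dirichlet endpoint.
   Context: A compact metric graph $\mathcal G$ is obtained from a finite combinatorial graph with vertex set $\mathcal V$ and finite edge set $\mathcal E$ by identifying the endpoints of compact intervals $[0,\ell_e]$, $\ell_e>0$, $e\in\mathcal E$, according to the graph structure; $|\mathcal G|=\sum_{e}\ell_e$. $\mathcal E_v$ is the set of edges incident with $v$ (a loop at $v$ counted twice, once for each endpoint) and $\deg(v)=|\mathcal E_v|$. Set $\mathcal V^N=\mathcal V\setminus\mathcal V^D$. $u_e$ denotes the restriction of $u$ to $e$. $W^{1,p}(\mathcal G)$ is the space of $u:\mathcal G\to\mathbb R$ with $u|_e\in W^{1,p}(0,\ell_e)$ for all $e\in\mathcal E$ and $u$ continuous at every vertex; $W^{1,p}_{\mathcal V^D}(\mathcal G)=\{u\in W^{1,p}(\mathcal G): u(v)=0\ \forall v\in\mathcal V^D\}$. Integrals over $\mathcal G$ are sums of integrals over edges. The $p$-torsion function $w_p$ is the unique function in $W^{1,p}_{\mathcal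 V^D}(\mathcal G)$ with $-(|w_{p,e}'|^{p-2}w_{p,e}')'=1$ on each edge $e$, $w_p(v)=0$ for $v\in\mathcal V^D$, and $\sum_{e\in\mathcal E_v}|w_{p,e}'(v)|^{p-2}\partial_{\nu_e}w_{p,e}(v)=0$ for $v\in\mathcal V^N$, where $\partial_{\nu_e}$ is the derivative at $v$ in the outward direction along $e$ (pointing from $v$ into $e$). Equivalently, $\int_{\mathcal G}|w_p'|^{p-2}w_p'\phi'\,dx=\int_{\mathcal G}\phi\,dx$ for all $\phi\in W^{1,p}_{\mathcal V^D}(\mathcal G)$. The $p$-torsional rigidity is $T_p(\mathcal G,\mathcal V^D)=\bigl(\int_{\mathcal G}w_p\,dx\bigr)^{p-1}$. ''$\mathcal G$ is an interval of length $L$ with a single Dirichlet endpoint'' means: up to subdivision by vertices of degree two, $\mathcal G$ is the metric graph $[0,L]$, and $\mathcal V^D$ consists of exactly one of its two endpoints. *)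

(* Defs.v *)
From HB Require Import structures.
From mathcomp Require Import all_boot all_order all_algebra.
From mathcomp Require Import all_classical all_reals all_analysis.

Set Implicit Arguments.
Unset Strict Implicit.
Unset Printing Implicit Defensive.

Import Order.TTheory GRing.Theory Num.Theory.
Import numFieldNormedType.Exports.

Local Open Scope classical_set_scope.
Local Open Scope ring_scope.

(* A compact metric graph; loops and parallel edges are allowed.  The edge [e]
   is the interval [[0, elen e]]; its endpoint 0 is glued to the vertex
   [incidence e false] and its endpoint [elen e] to [incidence e true]. *)
Record metric_graph (R : realType) := MetricGraph {
  vertex : finType;
  edge : finType;
  incidence : edge -> bool -> vertex;
  elen : edge -> R;
  elen_gt0 : forall e, 0 < elen e }.

Section Graph.
Context {R : realType}.
Implicit Type G : metric_graph R.

Definition total_length G : R := \sum_(e : edge G) elen e.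

(* The edge ends [(e, b)] attached to [v]: a loop contributes both its ends. *)
Definition edge_ends G (v : vertex G) : {set edge G * bool} :=
  [set i | incidence i.1 i.2 == v]%SET.

Definition degree G (v : vertex G) : nat := #|edge_ends v|.

Definition adjacent G : rel (vertex G) := fun v w =>
  [exists e : edge G, exists b : bool,
     (incidence e b == v) && (incidence e (~~ b) == w)].

Definition graph_connected G : Prop :=
  forall v w : vertex G, connect (@adjacent G) v w.

(* The interval [[0, L]] as a graph: vertex [false] is 0, vertex [true] is L. *)
Definition interval_graph (L : R) (L_gt0 : 0 < L) : metric_graph R :=
  @MetricGraph R bool unit (fun _ b => b) (fun _ => L) (fun _ => L_gt0).

(* Up to subdivision by vertices of degree two, [G] is [[0, L]] : its vertices
   and edges can be listed without repetition as x_0, ..., x_(n+1) and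
   c_0, ..., c_n, where c_i joins x_i to x_(i+1). *)
Definition is_interval_single_dirichlet G (VD : {set vertex G}) (L : R) : Prop :=
  total_length G = L /\
  exists (n : nat) (x : 'I_n.+2 -> vertex G) (c : 'I_n.+1 -> edge G),
    [/\ bijective x, bijective c,
        forall i : 'I_n.+1, exists b : bool,
          incidence (c i) b = x (widen_ord (leqnSn n.+1) i) /\
          incidence (c i) (~~ b) = x (lift ord0 i)
      & VD = [set x ord0]%SET \/ VD = [set x ord_max]%SET].

End Graph.

Section Sobolev.
Context {R : realType}.
Notation mu := (@lebesgue_measure R).

Definition test_function (a b : R) (phi : R -> R) : Prop :=
  (forall (n : nat) (x : R), derivable (derive1n n phi) x 1) /\
  (exists c d : R, [/\ a < c, d < b &
     forall x, x \notin `[c, d] -> phi x = 0]).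

Definition weak_derivative (a b : R) (u g : R -> R) : Prop :=
  forall phi, test_function a b phi ->
    \int[mu]_(x in `]a, b[) (u x * derive1 phi x) =
    - \int[mu]_(x in `]a, b[) (g x * phi x).

Definition in_Lp (p a b : R) (f : R -> R) : Prop :=
  (f \_ `]a, b[) \in Lfun mu p%:E.

Definition in_W1p (p a b : R) (u : R -> R) : Prop :=
  in_Lp p a b u /\ exists2 g, in_Lp p a b g & weak_derivative a b u g.

End Sobolev.

Section Torsion.
Context {R : realType}.
Notation mu := (@lebesgue_measure R).
Variables (G : metric_graph R) (VD : {set vertex G}) (p : R).

(* A function on the graph is given edgewise; only the values [u e x] with
   [0 <= x <= elen e] are meaningful. *)
Notation gfun := (edge G -> R -> R).

(* The point of [e] at distance [h] from its end [b]. *)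
Definition from_end (e : edge G) (b : bool) (h : R) : R :=
  if b then elen e - h else h.

Definition end_value (u : gfun) (i : edge G * bool) : R :=
  u i.1 (from_end i.1 i.2 0).

Definition graph_integral (u : gfun) : R :=
  \sum_(e : edge G) \int[mu]_(x in `[0, elen e]) u e x.

(* Elements of W^{1,p}(0, elen e) are identified with their continuous
   representatives on the closed edge, which is what gives them values at the
   vertices; continuity at a vertex says that the edge ends glued there carry
   the same value. *)
Definition in_W1p_graph (u : gfun) : Prop :=
  [/\ forall e, {within `[0, elen e], continuous (u e)},
      forall e, in_W1p p 0 (elen e) (u e)
    & forall i j : edge G * bool, incidence i.1 i.2 = incidence j.1 j.2 ->
        end_value u i = end_value u j].

Definition in_W1p_dirichlet (u : gfun) : Prop :=
  in_W1p_graph u /\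
  forall i : edge G * bool, incidence i.1 i.2 \in VD -> end_value u i = 0.

Definition outward_quotient (u : gfun) (i : edge G * bool) (h : R) : R :=
  (u i.1 (from_end i.1 i.2 h) - end_value u i) / h.

Definition outward_derivative (u : gfun) (i : edge G * bool) : R :=
  lim (outward_quotient u i h @[h --> 0^'+]).

(* For 1 < p this vanishes at [s = 0], also when [p - 2 <= 0]. *)
Definition p_flux (s : R) : R := `|s| `^ (p - 2) * s.

(* The one-sided derivative of [w e] at a vertex is the outward derivative up
   to sign, so [|w_e'(v)|^(p-2)] may be computed from the latter. *)
Definition is_p_torsion_function (w : gfun) : Prop :=
  [/\ in_W1p_dirichlet w,
      forall e x, x \in `]0, elen e[ ->
        [/\ derivable (w e) x 1,
            derivable (fun y => p_flux (derive1 (w e) y)) x 1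
          & - derive1 (fun y => p_flux (derive1 (w e) y)) x = 1]
    & forall v, v \notin VD ->
        (forall i, i \in edge_ends v ->
           cvg (outward_quotient w i h @[h --> 0^'+])) /\
        \sum_(i in edge_ends v) p_flux (outward_derivative w i) = 0].

(* For 1 < p and VD meeting every component such a function exists and its
   values on the edges are unique, so the default 0 is never used then. *)
Definition p_torsion_function : gfun :=
  xget (fun _ _ => 0) [set w | is_p_torsion_function w].

Definition p_torsional_rigidity : R :=
  graph_integral p_torsion_function `^ (p - 1).

End Torsion.

(* Main.v *)
Require Import Defs.
From mathcomp Require Import all_boot all_order all_algebra.
From mathcomp Require Import ring lra.
From mathcomp Require Import all_classical all_reals all_analysis.
From mathcomp Require Import measurable_realfun.

Set Implicit Arguments.
Unset Strict Implicit.
Unset Printing Implicit Defensive.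

Import Order.TTheory GRing.Theory Num.Theory.
Import numFieldNormedType.Exports.

Local Open Scope classical_set_scope.
Local Open Scope ring_scope.

(* On an edge the torsion function has flux |w'|^(p-2) w' = c - x, so it is
   explicit and everything reduces to finitely many fluxes c.  Integrating by
   parts against a flux d obeying Kirchhoff's law off the Dirichlet set, the
   integral of w equals the sum of the edge energies K(c), where K(c) is the
   integral of |c - x|^q over the edge, and strict convexity of K makes c the
   unique minimizer of this energy (dual variational principle).  An upper
   bound thus follows from any competitor d.  Order the edges so that each one
   meets a fixed Dirichlet vertex v0 or an earlier edge and let all mass flow
   to v0 along this order: the last edge carries at most the mass m of the
   sources behind it, hence has energy
   ((m + l)^(q+1) - m^(q+1)) / (q + 1) <= ((A + l)^(q+1) - A^(q+1)) / (q + 1)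
   with A the mass of all edges already removed, and the bound telescopes to
   L^(q+1) / (q + 1).  Equality forces m = A each time, so the edges form a
   walk, and d = c, so w increases strictly along it. *)

(** * Odd and even powers: monotonicity, continuity, derivatives *)

Section PowerFunctions.
Context {R : realType}.
Implicit Types (r s t x : R).

Lemma p_flux0 r : p_flux r 0 = 0.
Proof. by rewrite /p_flux mulr0. Qed.

Lemma p_fluxN r s : p_flux r (- s) = - p_flux r s.
Proof. by rewrite /p_flux normrN mulrN. Qed.

Lemma p_flux_powR r s : 0 < s -> p_flux r s = s `^ (r - 1).
Proof.
move=> s0; rewrite /p_flux gtr0_norm // -{2}(powRr1 (ltW s0)) -powRD.
  by congr (_ `^ _); lra.
by rewrite (gt_eqF s0) implybT.
Qed.

Lemma p_flux_gt0 r s : 0 < s -> 0 < p_flux r s.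
Proof. by move=> s0; rewrite p_flux_powR // powR_gt0. Qed.

Lemma p_flux_lt r : 1 < r -> {homo @p_flux R r : s t / s < t}.
Proof.
move=> r1.
have pos s t : 0 <= s -> s < t -> p_flux r s < p_flux r t.
  rewrite le_eqVlt => /predU1P[<- t0|s0 st].
    by rewrite p_flux0 p_flux_gt0.
  have t0 := lt_trans s0 st.
  by rewrite !p_flux_powR // gt0_ltr_powR ?nnegrE ?subr_gt0 // ltW.
move=> s t st; case: (leP 0 s) => [/pos|s0]; first exact.
case: (ltP 0 t) => [t0|t0]; last first.
  by rewrite -ltrN2 -!p_fluxN pos // ?oppr_ge0 // ltrN2.
apply: (lt_trans _ (p_flux_gt0 _ t0)).
by rewrite -oppr_gt0 -p_fluxN p_flux_gt0 // oppr_gt0.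
Qed.

Lemma p_flux_mulr r s : 1 < r -> p_flux r s * s = `|s| `^ r.
Proof.
move=> r1.
have pos t : 0 < t -> p_flux r t * t = `|t| `^ r.
  move=> t0; rewrite p_flux_powR // gtr0_norm // mulrC mulr_powRB1 ?ltW //.
  exact: lt_trans r1.
have [s0|s0|<-] := ltgtP 0 s; first exact: pos.
  by rewrite -normrN -pos ?oppr_gt0 // p_fluxN mulrNN.
by rewrite mulr0 normr0 powR0 // gt_eqF // (lt_trans _ r1).
Qed.

(** Since (q - 1) (p - 1) = 1, the two odd powers are inverse to each other; this turns the flux
    [c - x] back into w' = [p_flux q (c - x)]. *)
Lemma p_fluxK (p q : R) : 1 < p -> q = p / (p - 1) ->
  cancel (@p_flux R q) (p_flux p).
Proof.
move=> p1 qE s.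
have pos t : 0 < t -> p_flux p (p_flux q t) = t.
  move=> t0; rewrite [p_flux q t]p_flux_powR // p_flux_powR ?powR_gt0 //.
  rewrite -powRrM -[RHS]powRr1 ?ltW //; congr (_ `^ _).
  by rewrite qE; field; rewrite subr_eq0 gt_eqF.
have [s0|s0|<-] := ltgtP 0 s; first exact: pos.
  by apply: oppr_inj; rewrite -!p_fluxN pos // oppr_gt0.
by rewrite !p_flux0.
Qed.

Lemma conjugate_gt1 (p q : R) : 1 < p -> q = p / (p - 1) -> 1 < q.
Proof. by move=> p1 ->; rewrite ltr_pdivlMr ?subr_gt0 //; lra. Qed.

Lemma conjugate_sym (p q : R) : 1 < p -> q = p / (p - 1) -> p = q / (q - 1).
Proof.
move=> p1 qE; have q1 := conjugate_gt1 p1 qE.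
have h : q * (p - 1) = p by rewrite qE divfK // subr_eq0 gt_eqF.
have q0 : q - 1 != 0 by rewrite subr_eq0 gt_eqF.
apply: (mulIf q0); rewrite divfK //; nra.
Qed.

Lemma continuous_norm_powR r : 0 < r -> continuous (fun s => `|s| `^ r).
Proof.
move=> r0 s; have [->|s0] := eqVneq s 0.
  apply/cvgrPdist_lt => e e0; rewrite normr0 powR0 ?gt_eqF //.
  near=> t; rewrite sub0r normrN ger0_norm ?powR_ge0 //.
  (* At 0 the r-th root of [e] serves as delta. *)
  have -> : e = (e `^ r^-1) `^ r.
    by rewrite -powRrM mulVf ?gt_eqF // powRr1 // ltW.
  rewrite gt0_ltr_powR ?nnegrE ?powR_ge0 //.
  near: t; have : (fun t : R => `|t|) @ 0 --> (0 : R).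
    by rewrite -[X in _ --> X](@normr0 R R); exact: norm_continuous.
  by move=> /cvgr_lt; apply; rewrite powR_gt0.
apply: (@continuous_comp _ _ _ (fun t : R => `|t|) (@powR R ^~ r)).
  exact: norm_continuous.
apply/differentiable_continuous/derivable1_diffP/derivable_powR.
by rewrite in_itv/= andbT normr_gt0.
Unshelve. all: by end_near. Qed.

(** For r < 2 the factor |s|^(r-2) is unbounded near 0, so continuity at 0 comes from the bound
    |s|^(r-1). *)
Lemma continuous_p_flux r : 1 < r -> continuous (@p_flux R r).
Proof.
move=> r1 s; have [->|s0] := eqVneq s 0; last first.
  have d : {for s, continuous (fun t : R => `|t| `^ (r - 2))}.
    apply: (@continuous_comp _ _ _ (fun t : R => `|t|) (@powR R ^~ (r - 2))).
      exact: norm_continuous.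
    apply/differentiable_continuous/derivable1_diffP/derivable_powR.
    by rewrite in_itv/= andbT normr_gt0.
  exact: cvgM d cvg_id.
have r0 : 0 < r - 1 by rewrite subr_gt0.
have := continuous_norm_powR r0; move/(_ 0)/cvgrPdist_lt => H.
apply/cvgrPdist_lt => e /H.
apply: filterS => t; rewrite normr0 powR0 ?gt_eqF // p_flux0 !sub0r !normrN.
move=> h; apply: le_lt_trans h; rewrite [leRHS]ger0_norm ?powR_ge0 //.
have [->|t0] := eqVneq t 0; first by rewrite p_flux0 normr0 powR_ge0.
have -> : `|p_flux r t| = p_flux r `|t|.
  by rewrite /p_flux normrM ger0_norm ?powR_ge0 // normr_id.
by rewrite p_flux_powR ?normr_gt0.
Qed.

Lemma is_derive_norm_powR r x : 1 < r ->
  is_derive x 1 (fun s => `|s| `^ r) (r * p_flux r x).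
Proof.
move=> r1; have r0 : 0 < r by rewrite (lt_trans _ r1).
have pos t : 0 < t -> is_derive t 1 (fun s : R => `|s| `^ r) (r * p_flux r t).
  move=> t0; rewrite p_flux_powR //.
  have := is_derive1_powR r t0; apply: near_eq_is_derive; rewrite ?oner_eq0 //.
  near=> y; rewrite gtr0_norm //; near: y; exact: lt_nbhsr.
have [x0|x0|<-] := ltgtP 0 x; first exact: pos.
  have nx : 0 < - x by rewrite oppr_gt0.
  have -> : (fun s : R => `|s| `^ r) = (fun s : R => `|s| `^ r) \o -%R.
    by apply/funext => s /=; rewrite normrN.
  have -> : r * p_flux r x = (r * p_flux r (- x)) * (- 1).
    by rewrite p_fluxN; ring.
  have dN : is_derive x 1 (-%R : R -> R) (- 1).
    by apply: is_derive_eq.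
  exact: (is_derive1_comp (pos _ nx) dN).
(* At 0 the difference quotient |h|^r / h is [p_flux r h], which tends to 0. *)
have H : h^-1 *: (`|h *: (1 : R) + 0| `^ r - `|0 : R| `^ r) @[h --> 0^'] -->
    (0 : R).
  have /continuous_withinNx : {for 0, continuous (@p_flux R r)}.
    exact: continuous_p_flux.
  rewrite p_flux0; apply: cvg_trans.
  apply: near_eq_cvg; near=> h.
  have h0 : h != 0 by near: h; exact: nbhs_dnbhs_neq.
  rewrite normr0 powR0 ?gt_eqF // subr0 addr0 [h *: _]mulr1 -p_flux_mulr //.
  by rewrite -[_ *: _]/(_ * _) mulrC mulfK.
split; first by apply/cvg_ex; exists 0.
by rewrite p_flux0 mulr0; apply/cvg_lim.
Unshelve. all: by end_near. Qed.

Lemma is_derive_powR_primitive r x : 1 < r ->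
  is_derive x 1 (fun s => `|s| `^ r * s / (r + 1)) (`|x| `^ r).
Proof.
move=> r1; have d := is_derive_norm_powR x r1.
have -> : (fun s => `|s| `^ r * s / (r + 1)) =
    (r + 1)^-1 *: ((fun s => `|s| `^ r) * id).
  by apply/funext => s; rewrite -[RHS]/(_ * (_ * _)) mulrC.
apply: is_derive_eq; rewrite /= -![_ *: _]/(_ * _) -(p_flux_mulr x r1).
by field; rewrite gt_eqF // addr_gt0 // (lt_trans _ r1).
Qed.
End PowerFunctions.

(** * Strict convexity of the edge energy and growth of its increments *)

Section EdgeEnergy.
Context {R : realType}.
Implicit Types (q l c d m A s x : R).

Lemma MVT_everywhere (f df : R -> R) (a b : R) :
  (forall x, is_derive x 1 f (df x)) -> a < b ->
  exists2 c, c \in `]a, b[ & f b - f a = df c * (b - a).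
Proof.
move=> fdf ab; apply: MVT => // x.
apply: continuous_subspaceT => {}x.
exact/differentiable_continuous/derivable1_diffP.
Qed.

(** The odd primitive of |s|^q; at the total length it is the claimed bound before the power p - 1
    is taken. *)
Definition powR_primitive q s : R := `|s| `^ q * s / (q + 1).

(* With [f x = c - x], this is the integral of [`|f| `^ q] over [0, l]. *)
Definition edge_energy q l c : R :=
  powR_primitive q c + powR_primitive q (l - c).

Lemma powR_primitiveN q s : powR_primitive q (- s) = - powR_primitive q s.
Proof. by rewrite /powR_primitive normrN mulrN mulNr. Qed.

Lemma powR_primitive_ge0E q s : 0 < q -> 0 <= s ->
  powR_primitive q s = s `^ (q + 1) / (q + 1).
Proof.
move=> q0 s0; rewrite /powR_primitive ger0_norm // powRD ?powRr1 //.
by rewrite gt_eqF // addr_gt0.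
Qed.

Lemma powR_primitive_ge0 q s : 0 < q -> 0 <= s -> 0 <= powR_primitive q s.
Proof.
move=> q0 s0; rewrite powR_primitive_ge0E // divr_ge0 ?powR_ge0 //.
by rewrite addr_ge0 // ltW.
Qed.

Lemma is_derive_comp_subl (f df : R -> R) c x :
  (forall s, is_derive s 1 f (df s)) ->
  is_derive x 1 (fun s => f (c - s)) (- df (c - x)).
Proof.
move=> fdf; have d : is_derive x 1 (fun s => c - s) (- 1).
  by apply: is_derive_eq; rewrite add0r mul1r.
have := @is_derive1_comp _ f (fun s => c - s) x _ _ (fdf _) d.
by rewrite mulrN1.
Qed.

Lemma is_derive_comp_addr (f df : R -> R) c x :
  (forall s, is_derive s 1 f (df s)) ->
  is_derive x 1 (fun s => f (s + c)) (df (x + c)).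
Proof.
move=> fdf; have d : is_derive x 1 (fun s => s + c) 1.
  by apply: is_derive_eq; rewrite addr0.
have := @is_derive1_comp _ f (fun s => s + c) x _ _ (fdf _) d.
by rewrite mulr1.
Qed.

(** The difference is the slope of [edge_energy] in the flux. Its own derivative at x is q times
    [p_flux q x - p_flux q (x - l)], which is positive because [p_flux] increases. *)
Lemma norm_powR_sub_lt q l c d : 1 < q -> 0 < l -> c < d ->
  `|c| `^ q - `|l - c| `^ q < `|d| `^ q - `|l - d| `^ q.
Proof.
move=> q1 l0 cd; have q0 : 0 < q := lt_trans ltr01 q1.
pose df x : R := q * p_flux q x.
have dp x : is_derive x 1 (fun s : R => `|s| `^ q) (df x).
  exact: is_derive_norm_powR.
have dk x : is_derive x 1 (fun s : R => `|s| `^ q - `|l - s| `^ q)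
    (df x - - df (l - x)).
  have := is_derive_comp_subl l x dp; exact: is_deriveB.
have [x _ e] := MVT_everywhere dk cd.
rewrite -subr_gt0 e mulr_gt0 ?(subr_gt0 c) // opprK /df -mulrDr mulr_gt0 //.
by rewrite -(opprB x l) p_fluxN subr_gt0 p_flux_lt // ltrBlDr ltrDl.
Qed.

(** Strict convexity: the energy lies above its tangent at [c]. By the mean value theorem the chord
    has the slope of an intermediate point. *)
Lemma edge_energy_tangent q l c d : 1 < q -> 0 < l -> d != c ->
  (d - c) * (`|c| `^ q - `|l - c| `^ q) < edge_energy q l d - edge_energy q l c.
Proof.
move=> q1 l0 dc; have q0 : 0 < q := lt_trans ltr01 q1.
have dp x : is_derive x 1 (@powR_primitive q) (`|x| `^ q).
  exact: is_derive_powR_primitive.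
have dk x : is_derive x 1 (edge_energy q l) (`|x| `^ q - `|l - x| `^ q).
  have := is_derive_comp_subl l x dp; exact: is_deriveD.
have [cd|cd|e] := ltgtP c d; last by rewrite e eqxx in dc.
- have [x + ->] := MVT_everywhere dk cd; rewrite in_itv => /andP[cx xd].
  by rewrite mulrC ltr_pM2r ?subr_gt0 // norm_powR_sub_lt.
have [x + e] := MVT_everywhere dk cd; rewrite in_itv => /andP[cx xd].
rewrite -[ltRHS]opprB e -mulrN opprB mulrC ltr_nM2r ?subr_lt0 //.
exact: norm_powR_sub_lt.
Qed.

(** By symmetry the tangent at [l / 2] is horizontal, so the minimum is taken there. *)
Lemma edge_energy_ge0 q l c : 1 < q -> 0 < l -> 0 <= edge_energy q l c.
Proof.
move=> q1 l0; have q0 : 0 < q := lt_trans ltr01 q1.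
have h : edge_energy q l (l / 2) = powR_primitive q (l / 2) *+ 2.
  by rewrite /edge_energy mulr2n; congr (_ + powR_primitive _ _); field.
have h0 : 0 <= edge_energy q l (l / 2).
  by rewrite h mulrn_wge0 // powR_primitive_ge0 // divr_ge0 // ltW.
have [->//|ne] := eqVneq c (l / 2).
apply: (le_trans h0); rewrite -subr_ge0; apply: ltW.
apply: le_lt_trans (edge_energy_tangent q1 l0 ne).
have -> : l - l / 2 = l / 2 by field.
by rewrite subrr mulr0.
Qed.

(** The increment over a step [l] has derivative (x + l)^q - x^q > 0 for x > 0. This permits
    replacing the mass carried by an edge by the larger mass [A]. *)
Lemma powR_primitive_increment_lt q l m A : 1 < q -> 0 < l -> 0 <= m -> m < A ->
  powR_primitive q (m + l) - powR_primitive q m <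
  powR_primitive q (A + l) - powR_primitive q A.
Proof.
move=> q1 l0 m0 mA; have q0 : 0 < q := lt_trans ltr01 q1.
have dp x : is_derive x 1 (@powR_primitive q) (`|x| `^ q).
  exact: is_derive_powR_primitive.
have dk x : is_derive x 1
    (fun x => powR_primitive q (x + l) - powR_primitive q x)
    (`|x + l| `^ q - `|x| `^ q).
  have := is_derive_comp_addr l x dp; move=> ?; exact: is_deriveB.
have [x + e] := MVT_everywhere dk mA; rewrite in_itv => /andP[mx _].
have x0 := le_lt_trans m0 mx.
rewrite -subr_gt0 e mulr_gt0 ?subr_gt0 // !gtr0_norm ?addr_gt0 //.
by rewrite gt0_ltr_powR ?nnegrE ?addr_ge0 ?ltW // ltrDl.
Qed.

Lemma powR_primitive_increment_le q l m A : 1 < q -> 0 < l -> 0 <= m ->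
  m <= A ->
  powR_primitive q (m + l) - powR_primitive q m <=
  powR_primitive q (A + l) - powR_primitive q A.
Proof.
move=> q1 l0 m0; rewrite le_eqVlt => /predU1P[->//|mA].
exact/ltW/powR_primitive_increment_lt.
Qed.

End EdgeEnergy.

(** * Solving the torsion equation on one edge *)

Section EdgeProfile.
Context {R : realType}.
Notation mu := (@lebesgue_measure R).
Implicit Types (p q l a c x : R) (w : R -> R).

(* The solution of [- p_flux (w')' = 1] with [w 0 = a] and flux [c] at 0. *)
Definition edge_profile q a c x : R := a + (`|c| `^ q - `|c - x| `^ q) / q.

Lemma edge_profile0 q a c : edge_profile q a c 0 = a.
Proof. by rewrite /edge_profile subr0 subrr mul0r addr0. Qed.

Lemma is_derive_edge_profile q a c x : 1 < q ->
  is_derive x 1 (edge_profile q a c) (p_flux q (c - x)).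
Proof.
move=> q1; have q0 : 0 < q := lt_trans ltr01 q1.
have d : is_derive x 1 (fun s => `|c - s| `^ q) (- (q * p_flux q (c - x))).
  apply: (@is_derive_comp_subl R (fun s => `|s| `^ q)
    (fun s => q * p_flux q s)).
  by move=> s; exact: is_derive_norm_powR.
have -> : edge_profile q a c =
    (cst (a + `|c| `^ q / q) - q^-1 *: (fun s => `|c - s| `^ q)).
  apply/funext => s; rewrite /edge_profile -[RHS]/(_ + _ - (_ * _)); field.
  by rewrite gt_eqF.
apply: is_derive_eq; rewrite sub0r -[_ *: _]/(_ * _) mulrN opprK mulKf //.
by rewrite gt_eqF.
Qed.

Lemma continuous_edge_profile q a c : 1 < q -> continuous (edge_profile q a c).
Proof.
move=> q1 x; apply/differentiable_continuous/derivable1_diffP.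
by have [] := is_derive_edge_profile a c x q1.
Qed.

Lemma is_derive0_constant (f : R -> R) (a b : R) : a <= b ->
  (forall x, x \in `]a, b[ -> is_derive x 1 f 0) ->
  {within `[a, b], continuous f} -> f a = f b.
Proof.
move=> ab fd fc; apply/eqP; rewrite eq_sym -subr_eq0.
by have [z _ ->] := MVT_segment ab fd fc; rewrite mul0r.
Qed.

(** The flux plus x has derivative 0, hence is a constant [c]; inverting [p_flux] gives w', and w
    minus the profile is constant with value 0 at 0. *)
Lemma edge_profileP p q l w : 1 < p -> q = p / (p - 1) -> 0 < l ->
  {within `[0, l], continuous w} ->
  (forall x, x \in `]0, l[ ->
    [/\ derivable w x 1,
        derivable (fun y => p_flux p (derive1 w y)) x 1
      & - derive1 (fun y => p_flux p (derive1 w y)) x = 1]) ->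
  exists c, forall x, x \in `[0, l] -> w x = edge_profile q (w 0) c x.
Proof.
move=> p1 qE l0 wc wode; have q1 := conjugate_gt1 p1 qE.
pose g y := p_flux p (derive1 w y) + y.
have gd x : x \in `]0, l[ -> is_derive x 1 g 0.
  move=> /wode[_ d2 d2E].
  have d : is_derive x 1 (fun y => p_flux p (derive1 w y)) (- 1).
    by split => //; rewrite -derive1E -d2E opprK.
  by apply: is_derive_eq; rewrite addNr.
have gcst x y : x \in `]0, l[ -> y \in `]0, l[ -> g x = g y.
  wlog xy : x y / x <= y.
    move=> H xl yl; case: (leP x y) => [/H|/ltW/H]; first exact.
    by move=> /(_ yl xl).
  move=> /[!in_itv]/= /andP[x0 xl] /andP[y0 yl].
  have sub z : z \in `[x, y] -> z \in `]0, l[.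
    rewrite !in_itv/= => /andP[xz zy].
    by rewrite (lt_le_trans x0 xz) (le_lt_trans zy yl).
  have gd' z : z \in `]x, y[ -> is_derive z 1 g 0.
    by move=> zxy; apply/gd/sub; exact: subset_itv_oo_cc.
  have gc : {within `[x, y], continuous g}.
    apply: derivable_within_continuous => z /sub zl.
    by have [] := gd z zl.
  exact: (is_derive0_constant xy gd' gc).
(* The equation holds on the open edge only, so [c] is read off at an interior point. *)
pose c := g (l / 2); exists c => x xl.
have l2 : l / 2 \in `]0, l[ by rewrite in_itv/=; lra.
have wd y : y \in `]0, l[ -> is_derive y 1 w (p_flux q (c - y)).
  move=> yl; have [wy _ _] := wode y yl; split => //.
  rewrite -derive1E /c -(gcst y) // /g addrK.
  by rewrite (p_fluxK (conjugate_gt1 p1 qE) (conjugate_sym p1 qE)).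
pose f y := w y - edge_profile q (w 0) c y.
have /eqP : f 0 = f x.
  move: xl; rewrite in_itv/= => /andP[x0 xl].
  have fd y : y \in `]0, x[ -> is_derive y 1 f 0.
    rewrite in_itv/= => /andP[y0 yx].
    have yl : y \in `]0, l[ by rewrite in_itv/= y0 (lt_le_trans yx xl).
    have dw := wd y yl; have dp := is_derive_edge_profile (w 0) c y q1.
    by have := is_deriveB dw dp; rewrite subrr.
  have wx : {within `[0, x], continuous w}.
    apply: continuous_subspaceW wc => y /=.
    by rewrite !in_itv/= => /andP[-> /le_trans]; exact.
  have fc : {within `[0, x], continuous f}.
    move=> y; apply: within_continuousB => // {}y.
    by apply: continuous_subspaceT; exact: continuous_edge_profile.
  exact: (is_derive0_constant x0 fd fc).
by rewrite /f edge_profile0 subrr eq_sym subr_eq0 => /eqP.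
Qed.

(** This is integration by parts against the flux [c - x]: two boundary terms, end value times
    outgoing flux, plus the integral of w' (c - x) = |c - x|^q. The proof evaluates an explicit
    primitive [F]. *)
Lemma Rintegral_edge_profile q l a c : 1 < q -> 0 < l ->
  \int[mu]_(x in `[0, l]) edge_profile q a c x =
  a * c + edge_profile q a c l * (l - c) + edge_energy q l c.
Proof.
move=> q1 l0; have q0 : 0 < q := lt_trans ltr01 q1.
pose F x := (a + `|c| `^ q / q) * x + powR_primitive q (c - x) / q.
have dp x : is_derive x 1 (fun x => powR_primitive q (c - x)) (- `|c - x| `^ q).
  apply: (@is_derive_comp_subl _ (powR_primitive q) (fun s => `|s| `^ q)).
  move=> s; exact: is_derive_powR_primitive.
have dF x : is_derive x 1 F (edge_profile q a c x).
  have -> : F = (a + `|c| `^ q / q) *: id +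
      q^-1 *: (fun x => powR_primitive q (c - x)).
    by apply/funext => s; rewrite -[RHS]/(_ * _ + _ * _) /F [q^-1 * _]mulrC.
  have := is_deriveD (is_deriveZ (a + `|c| `^ q / q) (is_derive_id x 1))
    (is_deriveZ q^-1 (dp x)).
  congr is_derive; rewrite -![_ *: _]/(_ * _) /edge_profile; field.
  by rewrite gt_eqF.
have cF : continuous F.
  move=> x; apply/differentiable_continuous/derivable1_diffP.
  exact: ex_derive.
rewrite /Rintegral (@continuous_FTC2 _ _ F) //.
- rewrite -EFinB /= /F /edge_profile /edge_energy mulr0 subr0 add0r.
  rewrite -(opprB l c) powR_primitiveN normrN /powR_primitive.
  by field; rewrite !gt_eqF // addr_gt0.
- by apply: continuous_subspaceT; exact: continuous_edge_profile.
- split => [x _||]; first exact: ex_derive.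
    exact/cvg_at_right_filter/cF.
  exact/cvg_at_left_filter/cF.
- by move=> x _; rewrite derive1E; have [] := dF x.
Qed.

End EdgeProfile.

(** * Outward derivatives at the ends of an edge *)

Section OutwardDerivative.
Context {R : realType} (G : metric_graph R).
Implicit Types (q a : R) (c : edge G -> R) (i : edge G * bool).
Implicit Types (u : edge G -> R -> R).

(* The flux leaving the end [i] into an edge on which the flux is [c - x]. *)
Definition out_flux c i : R :=
  if i.2 then elen i.1 - c i.1 else c i.1.

Lemma cvg_outward_quotient q a c u i : 1 < q ->
  (forall x, x \in `[0, elen i.1] -> u i.1 x = edge_profile q a (c i.1) x) ->
  outward_quotient u i h @[h --> 0^'+] --> p_flux q (out_flux c i).
Proof.
case: i => e b; rewrite /out_flux /= => q1 uE; set d := p_flux q _.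
have l0 := elen_gt0 e.
(* The profile is smooth enough on the whole line, so the one-sided limit comes from a two-sided
   derivative. At the end [true] the reversed direction changes the sign, which oddness of [p_flux]
   absorbs. *)
pose f h := edge_profile q a (c e) (from_end e b h).
have df : is_derive (0 : R) (1 : R) f d.
  rewrite /f /d /from_end; case: b {f d uE} => /=; last first.
    by have := is_derive_edge_profile a (c e) 0 q1; rewrite subr0.
  have := @is_derive_comp_subl R (edge_profile q a (c e))
    (fun x => p_flux q (c e - x)) (elen e) 0.
  rewrite subr0 -p_fluxN opprB; apply => s.
  exact: is_derive_edge_profile.
have [f1 f2] := df.
have : h^-1 *: ((f \o shift 0) (h *: (1 : R)) - f 0) @[h --> 0^'] --> d.
  by rewrite -f2; exact: f1.
move=> /cvg_dnbhs_at_right; apply: cvg_trans; apply: near_eq_cvg.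
near=> h.
have h0 : 0 < h by near: h; exact: nbhs_right_gt.
have hl : h < elen e by near: h; exact: nbhs_right_lt.
rewrite /outward_quotient /end_value /= addr0 [h *: _]mulr1 /f.
rewrite [LHS]mulrC !uE // /from_end in_itv/=; case: (b) => /=; lra.
Unshelve. all: by end_near. Qed.

End OutwardDerivative.

(** * Ordering the edges outwards from a root vertex *)

Section AttachedEnumeration.
Context {R : realType} (G : metric_graph R).
Implicit Types (u v : vertex G) (e : edge G) (s : seq (edge G)).

Definition reached v0 s v :=
  (v == v0) || has (fun e => [exists b, incidence e b == v]) s.

(* The list is read from its end: each edge meets [v0] or a later edge. *)
Fixpoint attached v0 s :=
  if s is e :: s' then
    [exists b, reached v0 s' (incidence e b)] && attached v0 s'
  else true.

Lemma reached_cons v0 e s v :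
  reached v0 (e :: s) v = [exists b, incidence e b == v] || reached v0 s v.
Proof. by rewrite /reached /= orbCA. Qed.

Lemma reached_mem v0 e b s : e \in s -> reached v0 s (incidence e b).
Proof.
move=> es; apply/orP; right; apply/hasP; exists e => //.
by apply/existsP; exists b.
Qed.

Lemma reached_closed v0 s : graph_connected G ->
  (forall e b, reached v0 s (incidence e b) -> e \in s) ->
  forall v, reached v0 s v.
Proof.
move=> conn cl v; have /connectP[p] := conn v0 v.
have : reached v0 s v0 by rewrite /reached eqxx.
(* Only the start of the path is generalized; the root of [reached] stays [v0]. *)
elim: p {2 3 4}v0 => [|w p IH] x /= rx; first by move=> _ ->.
case/andP => /existsP[e /existsP[b /andP[/eqP xe /eqP we]]] pth.
apply: IH pth; rewrite -we; apply: reached_mem.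
by apply: (cl e b); rewrite xe.
Qed.

(** Induction on the size of the list: if no new edge could be attached, the list would be closed,
    so by connectedness it would contain every edge. *)
Lemma exists_attached_enum v0 : graph_connected G ->
  exists s, [/\ uniq s, attached v0 s & forall e, e \in s].
Proof.
move=> conn.
have [s [us ats ss]] :
    exists s, [/\ uniq s, attached v0 s & size s = #|edge G|].
  have : (#|edge G| <= #|edge G|)%N by [].
  elim: {1 3}#|edge G| => [|n IH] nE; first by exists [::].
  have [s [us ats ss]] := IH (ltnW nE).
  have [/existsP[e /andP[es att]]|/existsPn nex] :=
    boolP [exists e, (e \notin s) && [exists b, reached v0 s (incidence e b)]].
    by exists (e :: s); split; rewrite /= ?es ?us ?att ?ats ?ss.
  have sE : forall e, e \in s.
    have cl e b : reached v0 s (incidence e b) -> e \in s.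
      move=> r; have := nex e; rewrite negb_and negbK.
      by case/orP => [//|/existsPn/(_ b)]; rewrite r.
    by move=> e; apply: (cl e true); exact: reached_closed.
  have : (#|edge G| <= size s)%N.
    by rewrite cardE; apply: uniq_leq_size => [|e _]; rewrite ?enum_uniq ?sE.
  by rewrite ss leqNgt nE.
exists s; split => // e.
have /subset_cardP : #|s| = #|edge G| by rewrite (card_uniqP us).
by move=> /(_ (subset_predT _)) ->.
Qed.

End AttachedEnumeration.

(** * The competitor: a flow carrying all mass to the root *)

Section Flow.
Context {R : realType} (G : metric_graph R).
Implicit Types (u v : vertex G) (e : edge G) (s : seq (edge G)).
Implicit Types (a : vertex G -> R) (c : edge G -> R).

Definition net_flux c s v : R :=
  \sum_(e <- s) \sum_(b | incidence e b == v) out_flux c (e, b).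

Definition flow_energy (q : R) c s : R :=
  \sum_(e <- s) edge_energy q (elen e) (c e).

(* The vertices [vs] form a walk to [v0] along the edges [s], and [c] flows
   towards [v0], at least the length of the edge leaving each of them. *)
Definition flows_along v0 c s (vs : seq (vertex G)) : Prop :=
  [/\ size vs = (size s).+1, nth v0 vs (size s) = v0 &
    forall e0 i, (i < size s)%N -> exists b,
      [/\ incidence (nth e0 s i) b = nth v0 vs i.+1,
          incidence (nth e0 s i) (~~ b) = nth v0 vs i &
          elen (nth e0 s i) <= out_flux c (nth e0 s i, b)]].

Lemma eq_out_flux c c' (i : edge G * bool) : c i.1 = c' i.1 ->
  out_flux c i = out_flux c' i.
Proof. by rewrite /out_flux => ->. Qed.

(* Source [a v] at each vertex [v]; everything is carried to [v0].  An edge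
   closing a cycle carries only its own length. *)
Lemma exists_flow (q : R) v0 s a : 1 < q -> uniq s -> attached v0 s ->
  (forall v, 0 <= a v) -> (forall v, ~~ reached v0 s v -> a v = 0) ->
  let A := \sum_v a v in
  let bound :=
    powR_primitive q (A + \sum_(e <- s) elen e) - powR_primitive q A in
  exists c, [/\ forall v, v != v0 -> net_flux c s v = - a v,
    flow_energy q c s <= bound &
    flow_energy q c s = bound ->
      exists2 vs, flows_along v0 c s vs &
        forall v, a v != 0 -> v = nth v0 vs 0].
Proof.
move=> q1; elim: s a => [|e s IH] a.
  move=> _ _ a0 ar A bound; exists (fun _ => 0); split.
  - move=> v vv0; rewrite /net_flux big_nil ar ?oppr0 //.
    by rewrite /reached orbF.
  - by rewrite /flow_energy /bound !big_nil addr0 subrr.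
  - move=> _; exists [:: v0]; first by split.
    move=> v; apply: contraNeq => vv0; apply/eqP/ar.
    by rewrite /reached orbF.
move=> /andP[es us] /andP[/existsP[b ru] ats] a0 ar A bound.
set u := incidence e b in ru; set v := incidence e (~~ b).
set l := elen e; have l0 : 0 < l := elen_gt0 e.
(* [u] is the end of [e] towards [v0] and [v] the far end. The mass at [v] must leave through [e]
   unless a later edge meets [v]. *)
pose m := if reached v0 s v then 0 else a v.
have m0 : 0 <= m by rewrite /m; case: ifP.
have mA : m <= A.
  rewrite /m /A; case: ifP => _; first by rewrite sumr_ge0.
  by rewrite (bigD1 v) //= lerDl sumr_ge0.
(* [o b'] is the mass that [e] delivers at its end [b'], and [a'] is the source that remains for the
   other edges. The two values of [o] add up to [l], as outgoing fluxes of one edge must. *)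
pose o b' := if b' == b then m + l else - m.
pose a' z := a z + \sum_(b' | incidence e b' == z) o b'.
have a'E z : a' z =
    a z + (if u == z then m + l else 0) + (if v == z then - m else 0).
  rewrite /a' big_mkcond big_bool /o /u /v -addrA; congr (_ + _).
  by case: (b) => /=; rewrite // addrC.
have [||z|z nrz|c' [c'K c'le c'eq]] := IH a'; rewrite ?us ?ats //.
- rewrite a'E; have [<-|_] := eqVneq v z; last first.
    by rewrite addr0 addr_ge0 //; case: ifP => // _; rewrite addr_ge0 // ltW.
  rewrite /m; case: (boolP (reached v0 s v)) => rv.
    by rewrite oppr0 addr0 addr_ge0 //; case: ifP; rewrite ?add0r // ltW.
  case: ifP => _; last by rewrite addr0 subrr.
  by rewrite addrAC subrr add0r addr_ge0 // ltW.
- rewrite a'E; have [uz|uz] := eqVneq u z; first by rewrite -uz ru in nrz.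
  rewrite addr0; have [vz|vz] := eqVneq v z.
    by rewrite /m vz (negbTE nrz) subrr.
  rewrite addr0 ar // reached_cons negb_or nrz andbT.
  apply/existsPn => b'; move: uz vz; rewrite /u /v.
  by case: (b'); case: (b).
have sa' : \sum_z a' z = A + l.
  have point w (k : R) : \sum_z (if w == z then k else 0) = k.
    by rewrite -big_mkcond (big_pred1 w) // => z; rewrite eq_sym.
  rewrite (eq_bigr _ (fun z _ => a'E z)) !big_split /= !point -/A.
  by rewrite addrA addrAC addrK.
pose c e' := if e' == e then (if b then - m else m + l) else c' e'.
have oe b' : out_flux c (e, b') = o b'.
  rewrite /out_flux /c /o /= eqxx -/l; case: (b); case: b' => //=; ring.
have cs e' : e' \in s -> c e' = c' e'.
  by rewrite /c; case: eqP => // ->; rewrite (negbTE es).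
have ce : edge_energy q l (c e) = powR_primitive q (m + l) - powR_primitive q m.
  rewrite /edge_energy /c eqxx -powR_primitiveN.
  case: (b); rewrite ?opprK ?[l + m]addrC; first exact: addrC.
  by congr (_ + powR_primitive _ _); ring.
have fe : flow_energy q c (e :: s) =
    powR_primitive q (m + l) - powR_primitive q m + flow_energy q c' s.
  rewrite /flow_energy big_cons ce; congr (_ + _).
  by apply: eq_big_seq => e' /cs ->.
(* The total source has grown from [A] to [A + l], so the bound splits into the share of [e] and the
   bound of the induction hypothesis. *)
have boundE : bound = (powR_primitive q (A + l) - powR_primitive q A) +
    (powR_primitive q (\sum_z a' z + \sum_(e <- s) elen e)
       - powR_primitive q (\sum_z a' z)).
  by rewrite /bound big_cons sa' addrA; ring.
have inc := powR_primitive_increment_le q1 l0 m0 mA.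
exists c; split.
- move=> z zv0; rewrite /net_flux big_cons (eq_bigr o) //.
  rewrite (_ : \sum_(e' <- s) _ = net_flux c' s z); last first.
    apply: eq_big_seq => e' /cs ce'; apply: eq_bigr => b' _.
    exact: eq_out_flux.
  by rewrite c'K // /a'; ring.
- by rewrite fe boundE lerD.
rewrite fe boundE => feq.
(* Equality of the sums forces equality for [e] and for the rest; strict growth of the increments
   then leaves no room between [m] and [A]. *)
have {}mA : m = A.
  apply/eqP; rewrite eq_le mA leNgt; apply/negP => lt_mA.
  have := powR_primitive_increment_lt q1 l0 m0 lt_mA; lra.
have /c'eq[vs [svs lvs fvs] cvs] : flow_energy q c' s =
    powR_primitive q (\sum_z a' z + \sum_(e <- s) elen e)
       - powR_primitive q (\sum_z a' z) by lra.
exists (v :: vs).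
  split; rewrite /= ?svs // => e0 [_|i si] /=.
    exists b; split => //.
      (* The source [a' u] is at least [l], hence nonzero, so the walk for the remaining edges
         starts at [u]. *)
      apply: cvs; rewrite a'E eqxx; apply: lt0r_neq0.
      have : 0 <= a u := a0 u.
      have : 0 < l := l0.
      case: ifP => _; lra.
    by rewrite oe /o eqxx -/l lerDr.
  have [b' [h1 h2 h3]] := fvs e0 i si; exists b'; split => //.
  by rewrite (eq_out_flux (c' := c')) //= cs // mem_nth.
move=> z; rewrite /=; apply: contraNeq => zv.
(* Either [m = 0], and all sources vanish, or [m = a v], and [v] holds all the mass. *)
have sum0 : \sum_(w | w != v) a w = 0.
  move: mA; rewrite /m /A; case: ifP => _; rewrite (bigD1 v) //=.
    have := a0 v; have : 0 <= \sum_(w | w != v) a w by rewrite sumr_ge0.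
    lra.
  lra.
move/eqP: sum0; rewrite psumr_eq0 // => /allP/(_ z).
by rewrite mem_index_enum zv; apply.
Qed.

End Flow.

(** * The torsion function as minimizer of the dual energy *)

Section TorsionFlux.
Context {R : realType} (G : metric_graph R) (VD : {set vertex G}) (p q : R).
Implicit Types (c d : edge G -> R) (w : edge G -> R -> R).

Definition kirchhoff c : Prop :=
  forall v, v \notin VD -> \sum_(i in edge_ends v) out_flux c i = 0.

Definition graph_energy c : R := \sum_e edge_energy q (elen e) (c e).

Definition has_edge_profiles w c : Prop :=
  forall e x, x \in `[0, elen e] -> w e x = edge_profile q (w e 0) (c e) x.

Definition vertex_values w (val : vertex G -> R) : Prop :=
  (forall i, end_value w i = val (incidence i.1 i.2)) /\
  (forall v, v \in VD -> val v = 0).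

Hypotheses (p1 : 1 < p) (qE : q = p / (p - 1)).

Let q1 : 1 < q := conjugate_gt1 p1 qE.
Let q0 : 0 < q := lt_trans ltr01 q1.

Lemma torsion_vertex_values w : is_p_torsion_function VD p w ->
  exists val, vertex_values w val.
Proof.
move=> [[[_ _ wv] wD] _ _].
(* The default 0 is taken only at isolated vertices and respects the Dirichlet condition. *)
exists (fun v => if [pick i : edge G * bool | incidence i.1 i.2 == v] is Some i
  then end_value w i else 0); split => [i|v vD].
  case: pickP => [j /eqP ij|/(_ i)]; last by rewrite eqxx.
  exact: wv.
by case: pickP => // j /eqP jv; rewrite wD // jv.
Qed.

(** An outward derivative is [p_flux q] of the outgoing flux, so applying [p_flux p] makes the
    vertex condition linear in [c]. *)
Lemma torsion_flux w : is_p_torsion_function VD p w ->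
  exists2 c, has_edge_profiles w c & kirchhoff c.
Proof.
move=> [[[wc _ _] _] wode wK].
have /choice[c cP] e : exists ce : R, forall x, x \in `[0, elen e] ->
    w e x = edge_profile q (w e 0) ce x.
  exact: (edge_profileP p1 qE (elen_gt0 e) (wc e) (wode e)).
exists c => // v /wK[_ sum0]; rewrite -[RHS]sum0; apply: eq_bigr => i _.
rewrite -[LHS](p_fluxK p1 qE); congr p_flux; symmetry; apply/cvg_lim => //.
exact: (cvg_outward_quotient q1 (cP i.1)).
Qed.

(** Grouping the edge ends by vertex factors out [val v]; at each vertex either this value or the
    sum of the fluxes vanishes. *)
Lemma sum_vertex_values_flux w val d : vertex_values w val -> kirchhoff d ->
  \sum_e \sum_b end_value w (e, b) * out_flux d (e, b) = 0.
Proof.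
move=> [wv vD] dK; rewrite pair_bigA /=.
rewrite (partition_big (fun i : edge G * bool => incidence i.1 i.2) xpredT) //=.
apply: big1 => v _; rewrite (eq_bigr (fun i => val v * out_flux d i)); last first.
  by case=> e b /eqP /= <-; rewrite wv.
rewrite -mulr_sumr; have [vVD|vVD] := boolP (v \in VD).
  by rewrite vD // mul0r.
rewrite (eq_bigl (fun i => i \in edge_ends v)) ?dK ?mulr0 // => i.
by rewrite inE.
Qed.

Section Profile.
Variables (w : edge G -> R -> R) (val : vertex G -> R) (c : edge G -> R).
Hypotheses (wv : vertex_values w val) (wc : has_edge_profiles w c).

Lemma end_value_false e : end_value w (e, false) = w e 0.
Proof. by []. Qed.

Lemma end_value_true e :
  end_value w (e, true) = edge_profile q (w e 0) (c e) (elen e).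
Proof.
by rewrite /end_value /from_end /= subr0 wc // in_itv/= lexx ltW // elen_gt0.
Qed.

Lemma graph_integral_energy : kirchhoff c -> graph_integral w = graph_energy c.
Proof.
move=> cK; rewrite -[RHS]add0r -(sum_vertex_values_flux wv cK) -big_split /=.
apply: eq_bigr => e _.
transitivity (\int[lebesgue_measure]_(x in `[0, elen e])
    edge_profile q (w e 0) (c e) x).
  by apply: eq_Rintegral => x; rewrite inE; exact: wc.
rewrite Rintegral_edge_profile ?elen_gt0 //; congr (_ + _).
by rewrite big_bool end_value_true end_value_false /out_flux /= addrC.
Qed.

(** The slope of the edge energy at [c] is q times the difference of the end values of [w]. Hence
    the linear terms of the tangent inequality pair [w] with the difference of two Kirchhoff fluxes
    and cancel; only the convexity gaps remain. *)
Lemma graph_energy_min d : kirchhoff c -> kirchhoff d ->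
  graph_energy c <= graph_energy d /\
  (graph_energy c = graph_energy d -> d =1 c).
Proof.
move=> cK dK.
pose gap e := edge_energy q (elen e) (d e) - edge_energy q (elen e) (c e) -
  (d e - c e) * (`|c e| `^ q - `|elen e - c e| `^ q).
have gap_sum : graph_energy d - graph_energy c = \sum_e gap e.
  rewrite /gap !sumrB -[LHS]subr0; congr (_ - _).
  transitivity (q * (\sum_e \sum_b end_value w (e, b) * out_flux c (e, b) -
                    \sum_e \sum_b end_value w (e, b) * out_flux d (e, b))).
    by rewrite !(sum_vertex_values_flux wv) // subrr mulr0.
  rewrite -sumrB mulr_sumr; apply: eq_bigr => e _.
  rewrite !big_bool end_value_true end_value_false /out_flux /edge_profile /=.
  rewrite [`|elen e - c e|]distrC.
  by field; rewrite gt_eqF.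
have gap_gt0 e : d e != c e -> 0 < gap e.
  by move=> dc; rewrite subr_gt0 edge_energy_tangent // elen_gt0.
have gap_ge0 e : 0 <= gap e.
  have [dc|/gap_gt0/ltW//] := eqVneq (d e) (c e).
  by rewrite /gap dc !subrr mul0r subrr.
split; first by rewrite -subr_ge0 gap_sum sumr_ge0.
move=> E e; apply: contra_eq E => /gap_gt0 ge.
rewrite eq_sym -subr_eq0 gap_sum gt_eqF //.
by rewrite (bigD1 e) //= ltr_pwDl // sumr_ge0.
Qed.

(** The outgoing flux decreases at unit rate, so it stays positive until possibly the far end, and
    [w] rises along the whole edge. *)
Lemma end_value_increasing e b : elen e <= out_flux c (e, b) ->
  end_value w (e, b) < end_value w (e, ~~ b).
Proof.
have l0 := elen_gt0 e.
rewrite /out_flux; case: b => /= h; rewrite end_value_true end_value_false.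
  rewrite /edge_profile -subr_gt0 opprD addNKr -mulNr divr_gt0 // opprB subr_gt0.
  rewrite gt0_ltr_powR ?nnegrE //.
  have c0 : c e <= 0 by move: h; rewrite lerBrDr gerDl.
  rewrite ler0_norm // distrC gtr0_norm; lra.
rewrite /edge_profile ltrDl divr_gt0 // subr_gt0 gt0_ltr_powR ?nnegrE //.
rewrite ger0_norm ?subr_ge0 // gtr0_norm; lra.
Qed.

End Profile.
End TorsionFlux.

(** * The upper bound and its equality case *)

Section UpperBound.
Context {R : realType} (G : metric_graph R) (VD : {set vertex G}) (p q : R).
Hypotheses (p1 : 1 < p) (qE : q = p / (p - 1)) (conn : graph_connected G).
Implicit Types (c d : edge G -> R).

Let q1 : 1 < q := conjugate_gt1 p1 qE.
Let q0 : 0 < q := lt_trans ltr01 q1.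

Lemma sum_enum (s : seq (edge G)) (F : edge G -> R) : uniq s ->
  (forall e, e \in s) -> \sum_(e <- s) F e = \sum_e F e.
Proof.
move=> us sE; apply: perm_big; apply: uniq_perm; rewrite ?index_enum_uniq //.
by move=> e; rewrite mem_index_enum sE.
Qed.

(** [exists_flow] without initial sources: the single vertex [v0] absorbs everything, and flux
    balance holds at all other vertices, Dirichlet or not. *)
Lemma exists_tree_flow v0 : v0 \in VD -> exists d s,
  [/\ kirchhoff VD d, uniq s, forall e, e \in s,
      graph_energy q d <= powR_primitive q (total_length G) &
      graph_energy q d = powR_primitive q (total_length G) ->
        exists vs, flows_along v0 d s vs].
Proof.
move=> v0D; have [s [us ats sE]] := exists_attached_enum v0 conn.
have [||d [dK dle deq]] := @exists_flow _ _ q v0 s (fun=> 0) q1 us ats.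
- by [].
- by [].
have pr0 : powR_primitive q 0 = 0 by rewrite /powR_primitive mulr0 mul0r.
have sE0 : \sum_(v : vertex G) (0 : R) = 0 by exact: big1_eq.
have lE : \sum_(e <- s) elen e = total_length G by exact: sum_enum.
have eE : flow_energy q d s = graph_energy q d by exact: sum_enum.
rewrite /= sE0 add0r pr0 subr0 lE eE in dle deq.
exists d, s; split => // [v vD|E]; last by have [vs] := deq E; exists vs.
have /dK : v != v0 by apply: contraNneq vD => ->.
rewrite oppr0 => K0; rewrite -[RHS]K0 /net_flux sum_enum // pair_big_dep.
by apply: eq_big => [i|[e b]//]; rewrite inE.
Qed.

Lemma graph_integral_torsion_le w : VD != finset.set0 ->
  is_p_torsion_function VD p w ->
  graph_integral w <= powR_primitive q (total_length G).
Proof.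
move=> /set0Pn[v0 v0D] wt.
have [val wv] := torsion_vertex_values wt.
have [c wc cK] := torsion_flux p1 qE wt.
have [d [s [dK _ _ dle _]]] := exists_tree_flow v0D.
rewrite (graph_integral_energy p1 qE wv wc cK).
apply: (le_trans _ dle).
by have [] := graph_energy_min p1 qE wv wc cK dK.
Qed.

Lemma graph_integral_torsion_ge0 w : is_p_torsion_function VD p w ->
  0 <= graph_integral w.
Proof.
move=> wt.
have [val wv] := torsion_vertex_values wt.
have [c wc cK] := torsion_flux p1 qE wt.
rewrite (graph_integral_energy p1 qE wv wc cK) sumr_ge0 // => e _.
exact/edge_energy_ge0/elen_gt0.
Qed.

(** Each flux is a competitor for the other, so the two energies agree. The rigidity thus does not
    depend on which torsion function is chosen. *)
Lemma graph_integral_torsion_unique w w' : is_p_torsion_function VD p w ->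
  is_p_torsion_function VD p w' -> graph_integral w = graph_integral w'.
Proof.
move=> wt wt'.
have [val wv] := torsion_vertex_values wt.
have [val' wv'] := torsion_vertex_values wt'.
have [c wc cK] := torsion_flux p1 qE wt.
have [c' wc' cK'] := torsion_flux p1 qE wt'.
rewrite (graph_integral_energy p1 qE wv wc cK).
rewrite (graph_integral_energy p1 qE wv' wc' cK').
apply/eqP; rewrite eq_le.
have [-> _] := graph_energy_min p1 qE wv wc cK cK'.
by have [-> _] := graph_energy_min p1 qE wv' wc' cK' cK.
Qed.

(* In the equality case the tree flow is the flux of [w], so [w] strictly
   increases along the walk it follows; hence the walk is a simple path. *)
Lemma graph_integral_torsion_eq w : VD != finset.set0 ->
  is_p_torsion_function VD p w -> 0 < total_length G ->
  graph_integral w = powR_primitive q (total_length G) ->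
  is_interval_single_dirichlet VD (total_length G).
Proof.
move=> /set0Pn[v0 v0D] wt L0 wE.
have [val wv] := torsion_vertex_values wt.
have [c wc cK] := torsion_flux p1 qE wt.
have [d [s [dK us sE dle deq]]] := exists_tree_flow v0D.
rewrite (graph_integral_energy p1 qE wv wc cK) in wE.
have [cd cdeq] := graph_energy_min p1 qE wv wc cK dK.
have dE : graph_energy q d = powR_primitive q (total_length G).
  by apply/eqP; rewrite eq_le dle -wE.
have [vs [svs lvs fvs]] := deq dE.
have {}cdeq : d =1 c by apply: cdeq; rewrite wE dE.
case: s => [|e0 s'] in us sE fvs svs lvs deq *.
  move: L0; rewrite /total_length big1 ?ltxx // => e _.
  by have := sE e.
set s := e0 :: s' in us sE fvs svs lvs deq; set n := size s' in svs lvs fvs deq.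
have sn : size s = n.+1 by [].
have vdec : sorted (fun u v => val v < val u) vs.
  apply/(sortedP v0) => i; rewrite svs ltnS => si.
  have [b [<- <- h3]] := fvs e0 i si.
  have [wvE _] := wv; rewrite -(wvE (_, b)) -(wvE (_, ~~ b)).
  apply: (end_value_increasing p1 qE wc); apply: le_trans h3 _.
  by rewrite (eq_out_flux (c' := c)).
have tr : transitive (fun u v => val v < val u).
  by move=> y x z xy yz; exact: lt_trans yz xy.
have uvs : uniq vs.
  by apply: sorted_uniq vdec => // x; rewrite /= ltxx.
(* By connectedness every vertex is [v0] or an end of some edge, and every edge joins two
   consecutive vertices of the walk. *)
have vsE v : v \in vs.
  have : reached v0 s v.
    by apply: reached_closed => // e b _.
  case/orP => [/eqP->|/hasP[e es /existsP[b /eqP <-]]].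
    by rewrite -lvs mem_nth // svs.
  have [i si <-] : exists2 i, (i < size s)%N & nth e0 s i = e.
    by exists (index e s); rewrite ?index_mem ?nth_index.
  have [b' [h1 h2 _]] := fvs e0 i si.
  have [->|bb'] := eqVneq b b'; first by rewrite h1 mem_nth // svs.
  have -> : b = ~~ b' by case: (b) (b') bb' => -[].
  by rewrite h2 mem_nth // svs ltnS ltnW.
split => //; exists n, (fun i => nth v0 vs i), (fun i => nth e0 s i); split.
- exists (fun v => inord (index v vs)) => [i|v].
    apply: val_inj; rewrite [LHS]inordK index_uniq // ?svs //; exact: ltn_ord.
  by rewrite inordK ?nth_index // -[X in (_ < X)%N]svs index_mem.
- exists (fun e => inord (index e s)) => [i|e].
    apply: val_inj; rewrite [LHS]inordK index_uniq //; exact: ltn_ord.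
  by rewrite inordK ?nth_index // -[X in (_ < X)%N]sn index_mem.
- move=> i; have [b [h1 h2 _]] := fvs e0 i (ltn_ord i).
  by exists (~~ b); rewrite negbK h1 h2.
(* The walk ends at [v0]. Any other vertex comes earlier, where [val] exceeds [val v0 = 0], so it is
   not a Dirichlet vertex. *)
right; apply/setP => v; rewrite inE /= -[n.+1]/(size s) lvs.
apply/idP/eqP => [vD|-> //]; apply/eqP/negPn/negP => vv0.
have := vsE v; rewrite -index_mem svs ltnS leq_eqVlt => /orP[/eqP ie|ilt].
  by move: vv0; rewrite -lvs -ie nth_index // eqxx.
have /(_ (index v vs) (size s)) := sorted_ltn_nth tr v0 vdec.
rewrite !inE index_mem vsE svs ltnSn lvs nth_index //.
by have [_ wD] := wv; rewrite !wD // ltxx => /(_ isT isT ilt).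
Qed.

End UpperBound.

(** * Continuously differentiable functions are Sobolev functions *)

Section Sobolev.
Context {R : realType}.
Notation mu := (@lebesgue_measure R).
Implicit Types (p a b : R) (f g u phi : R -> R).

Lemma continuous_in_Lp p a b f : 0 < p -> continuous f -> in_Lp p a b f.
Proof.
move=> p0 cf; rewrite /in_Lp inE; apply/andP; split.
  rewrite inE /=; apply/(measurable_restrictT _ _).1; first exact: measurable_itv.
  by apply: measurable_funTS; exact: continuous_measurable_fun.
rewrite inE /= /finite_norm unlock poweR_lty //.
pose h x : R := `|f x| `^ p.
have ch : continuous h.
  move=> x; apply: (@continuous_comp _ _ _ f (fun s : R => `|s| `^ p)).
    exact: cf.
  exact: continuous_norm_powR.
have ih : mu.-integrable `]a, b[ (EFin \o h).
  apply: (@integrableS _ _ _ mu `[a, b]) => //; first exact: subset_itv_oo_cc.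
  apply: continuous_compact_integrable; first exact: segment_compact.
  exact: continuous_subspaceT.
have E x : (`|(f \_ `]a, b[) x| `^ p)%:E = ((EFin \o h) \_ `]a, b[) x.
  rewrite !patchE; case: ifP => //.
  by rewrite normr0 powR0 // gt_eqF.
under eq_integral do rewrite /= E.
rewrite -integral_mkcond.
exact: integrable_lty.
Qed.

Lemma test_function_continuous a b phi n : test_function a b phi ->
  continuous (derive1n n phi).
Proof. by move=> [d _] x; exact/differentiable_continuous/derivable1_diffP. Qed.

(** Integration by parts on the closed interval; the test function vanishes at both ends, and
    passing from the open to the closed interval leaves the integrals unchanged. *)
Lemma C1_weak_derivative a b u g : a < b -> continuous g ->
  (forall x : R, is_derive x 1 u (g x)) -> weak_derivative a b u g.
Proof.
move=> ab cg ug phi phit.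
have cphi : continuous phi := test_function_continuous (n := 0) phit.
have cphi' : continuous (derive1 phi) := test_function_continuous (n := 1) phit.
have dphi (x : R) : derivable phi x 1 by case: phit => /(_ 0%N x).
have cu : continuous u.
  by move=> x; apply/differentiable_continuous/derivable1_diffP; case: (ug x).
have [_ [c [d [ac db phi0]]]] := phit.
have phia : phi a = 0 by apply: phi0; rewrite in_itv/=; lra.
have phib : phi b = 0.
  by apply: phi0; rewrite in_itv/= [(b <= d)]leNgt db andbF.
have oc (h : R -> R) : continuous h ->
    \int[mu]_(x in `]a, b[) h x = \int[mu]_(x in `[a, b]) h x.
  move=> ch; rewrite /Rintegral [in RHS]integral_itv_bndoo //.
  apply/measurable_EFinP; apply: measurable_funTS.
  exact: continuous_measurable_fun.
have bnd (h : R -> R) : continuous h -> (forall x : R, derivable h x 1) ->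
    derivable_oo_LRcontinuous h a b.
  move=> ch dh; split => [x _||]; first exact: dh.
    exact/cvg_at_right_filter/ch.
  exact/cvg_at_left_filter/ch.
rewrite !oc; last 2 first.
- by move=> x; apply: cvgM; [exact: cg|exact: cphi].
- by move=> x; apply: cvgM; [exact: cu|exact: cphi'].
rewrite (@Rintegration_by_parts _ u phi g (derive1 phi)) //.
- by rewrite phia phib !mulr0 subrr sub0r.
- exact: (continuous_subspaceT cg).
- by apply: (bnd u cu) => x; case: (ug x).
- by move=> x _; rewrite derive1E; case: (ug x).
- exact: (continuous_subspaceT cphi').
- exact: (bnd phi cphi dphi).
Qed.

Lemma C1_in_W1p p a b u g : 0 < p -> a < b -> continuous g ->
  (forall x : R, is_derive x 1 u (g x)) -> in_W1p p a b u.
Proof.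
move=> p0 ab cg ug; split.
  apply: continuous_in_Lp => // x.
  by apply/differentiable_continuous/derivable1_diffP; case: (ug x).
by exists g; [exact: continuous_in_Lp|exact: C1_weak_derivative].
Qed.

End Sobolev.

(** * Torsion functions built from explicit edge profiles *)

Section ExplicitTorsion.
Context {R : realType} (G : metric_graph R) (VD : {set vertex G}) (p q : R).
Hypotheses (p1 : 1 < p) (qE : q = p / (p - 1)).

Let q1 : 1 < q := conjugate_gt1 p1 qE.

(** Converse of [torsion_flux]: a Kirchhoff flux whose profiles fit together at the vertices yields
    a torsion function. *)
Lemma edge_profiles_torsion (val : vertex G -> R) (d : edge G -> R) :
  (forall v, v \in VD -> val v = 0) -> kirchhoff VD d ->
  (forall e, edge_profile q (val (incidence e false)) (d e) (elen e) =
             val (incidence e true)) ->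
  is_p_torsion_function VD p
    (fun e => edge_profile q (val (incidence e false)) (d e)).
Proof.
move=> vD dK vE; set w := fun e => _.
have dw e (x : R) : is_derive x 1 (w e) (p_flux q (d e - x)).
  exact: is_derive_edge_profile.
have dwE e : derive1 (w e) = (fun x => p_flux q (d e - x)).
  by apply/funext => x; rewrite derive1E; case: (dw e x).
have pK := p_fluxK p1 qE.
have wv (i : edge G * bool) : end_value w i = val (incidence i.1 i.2).
  case: i => e [] /=; rewrite /end_value /from_end /= /w.
    by rewrite subr0 vE.
  by rewrite edge_profile0.
split.
- split=> [|i iD]; last by rewrite wv vD.
  split=> [e|e|i j ij].
  + by apply: continuous_subspaceT; exact: continuous_edge_profile.
  + apply: (C1_in_W1p (g := fun x => p_flux q (d e - x))) => //.
    * exact: lt_trans p1.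
    * exact: elen_gt0.
    * move=> x; apply: (@continuous_comp _ _ _ (fun x => d e - x) (p_flux q)).
        by apply: cvgB; [exact: cvg_cst|exact: cvg_id].
      exact: continuous_p_flux.
  + by rewrite !wv ij.
- move=> e x _.
  have fE : (fun y => p_flux p (derive1 (w e) y)) = (fun y => d e - y).
    by apply/funext => y; rewrite dwE pK.
  have df : is_derive x 1 (fun y => d e - y) (- 1).
    by apply: is_derive_eq; rewrite add0r mul1r.
  rewrite fE; split; first by case: (dw e x).
    by case: df.
  by rewrite derive1E; case: df => _ ->; rewrite opprK.
move=> v vVD.
have cvgi (i : edge G * bool) :
    outward_quotient w i h @[h --> 0^'+] --> p_flux q (out_flux d i).
  exact: (cvg_outward_quotient q1).
split=> [i _|]; first by apply/cvg_ex; exists (p_flux q (out_flux d i)).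
rewrite -[RHS](dK v vVD); apply: eq_bigr => i _.
rewrite -[RHS]pK; congr p_flux; apply/cvg_lim => //; exact: cvgi.
Qed.

End ExplicitTorsion.

(** * The torsion function of a subdivided interval *)

Lemma sum_consecutive_sub (V : zmodType) (F : nat -> V) n :
  \sum_(i < n) (F i - F i.+1) = F 0%N - F n.
Proof.
rewrite -(big_mkord xpredT (fun i => F i - F i.+1)) -[LHS]opprK -sumrN.
rewrite (eq_bigr (fun i => F i.+1 - F i)) => [|i _]; last by rewrite opprB.
by rewrite telescope_sumr // opprB.
Qed.

Section IntervalTorsion.
Context {R : realType} (G : metric_graph R) (p q : R).
Hypotheses (p1 : 1 < p) (qE : q = p / (p - 1)).

Let q1 : 1 < q := conjugate_gt1 p1 qE.
Let q0 : 0 < q := lt_trans ltr01 q1.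

Lemma path_torsion n (x : 'I_n.+2 -> vertex G) (c : 'I_n.+1 -> edge G) :
  bijective x -> bijective c ->
  (forall i : 'I_n.+1, exists b : bool,
     incidence (c i) b = x (widen_ord (leqnSn n.+1) i) /\
     incidence (c i) (~~ b) = x (lift ord0 i)) ->
  exists2 w, is_p_torsion_function [set x ord0]%SET p w &
    graph_integral w = powR_primitive q (total_length G).
Proof.
move=> [y xK yK] bc /choice[b bP]; have [k cK kK] := bc.
(* [P i] is the length of the path beyond [x i], seen from the Dirichlet vertex [x ord0]: the mass
   that must flow through [x i]. *)
pose P m : R := \sum_(j < n.+1 | (m <= j)%N) elen (c j).
have P0 : P 0%N = total_length G.
  by rewrite /P /total_length (reindex c) //=; exact: onW_bij.
have Pn : P n.+1 = 0.
  by rewrite /P big_pred0 // => j; rewrite leqNgt ltn_ord.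
have PS (i : 'I_n.+1) : P i = elen (c i) + P i.+1.
  rewrite /P (bigD1 i) //=; congr (_ + _); apply: eq_bigl => j.
  by rewrite andbC ltn_neqAle eq_sym.
have Pge0 m : 0 <= P m by rewrite sumr_ge0 // => j _; rewrite ltW // elen_gt0.
(* In either orientation the outgoing flux of the edge [c i] is [P i] at [x i] and [- P i.+1] at the
   next vertex. The values below integrate r^(q-1) from [P i] to [P 0]. *)
pose d e := if b (k e) then - P (k e).+1 else P (k e).
pose val v := (P 0%N `^ q - P (y v) `^ q) / q.
have dc i : d (c i) = if b i then - P i.+1 else P i by rewrite /d cK.
have valx i : val (x i) = (P 0%N `^ q - P i `^ q) / q by rewrite /val xK.
have val0 v : v \in [set x ord0]%SET -> val v = 0.
  by rewrite inE => /eqP->; rewrite valx subrr mul0r.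
have vE e : edge_profile q (val (incidence e false)) (d e) (elen e) =
    val (incidence e true).
  rewrite -(kK e); move: (k e) => i; rewrite dc /edge_profile.
  have [h1 h2] := bP i; have := PS i.
  have := Pge0 i; have := Pge0 i.+1.
  case: (b i) h1 h2 => /= -> -> Pi1 Pi PE; rewrite !valx lift0 /=.
    rewrite normrN -opprD normrN [P i.+1 + _]addrC -PE !ger0_norm //.
    by field; rewrite gt_eqF.
  rewrite [in `|P i - _|]PE addrAC subrr add0r !ger0_norm //.
  by field; rewrite gt_eqF.
have dK : kirchhoff [set x ord0]%SET d.
  move=> v; rewrite inE => vx0.
  (* The contributions at [v] telescope along the path: the term at 0 vanishes since [v] is not the
     Dirichlet vertex, the last one since [P n.+1 = 0]. *)
  pose F m := if x (inord m) == v then P m else 0.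
  transitivity (\sum_(i < n.+1) (F i - F i.+1)).
    rewrite [LHS](eq_bigl (fun i : edge G * bool => incidence i.1 i.2 == v)).
      rewrite -(pair_big_dep xpredT (fun e b' => incidence e b' == v)
        (fun e b' => out_flux d (e, b'))) /=.
      rewrite (reindex c) /=; last exact: onW_bij.
      apply: eq_bigr => i _; rewrite big_mkcond big_bool /F /out_flux /= dc.
      have -> : inord i = widen_ord (leqnSn n.+1) i :> 'I_n.+2.
        by apply: val_inj; rewrite /= inordK // ltnS ltnW.
      have -> : inord i.+1 = lift ord0 i :> 'I_n.+2.
        by apply: val_inj; rewrite /= inordK ?lift0 // ltnS.
      have [h1 h2] := bP i; have := PS i.
      case: (b i) h1 h2 => /= <- <- PE;
        case: eqP => _; case: eqP => _; rewrite ?PE; ring.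
    by move=> i; rewrite inE.
  rewrite sum_consecutive_sub /F Pn if_same subr0.
  have -> : inord 0 = ord0 :> 'I_n.+2 by apply: val_inj; rewrite /= inordK.
  by rewrite eq_sym (negbTE vx0).
exists (fun e => edge_profile q (val (incidence e false)) (d e)).
  exact: edge_profiles_torsion.
rewrite (@graph_integral_energy _ _ [set x ord0]%SET p q p1 qE _ val d) //.
- rewrite /graph_energy (reindex c) /=; last exact: onW_bij.
  transitivity (\sum_(i < n.+1)
      (powR_primitive q (P i) - powR_primitive q (P i.+1))).
    apply: eq_bigr => i _; rewrite /edge_energy dc -powR_primitiveN (PS i).
    case: (b i); rewrite ?opprK; first by rewrite addrC.
    by congr (_ + powR_primitive _ _); ring.
  rewrite (sum_consecutive_sub (fun i => powR_primitive q (P i))) Pn P0.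
  by rewrite /powR_primitive mulr0 mul0r subr0.
- split=> // -[e []] /=; rewrite /end_value /from_end /=.
    by rewrite subr0 vE.
  by rewrite edge_profile0.
- by move=> e s _; rewrite edge_profile0.
Qed.

Lemma interval_torsion (VD : {set vertex G}) L :
  is_interval_single_dirichlet VD L ->
  exists2 w, is_p_torsion_function VD p w &
    graph_integral w = powR_primitive q L.
Proof.
move=> [<- [n [x [c [bx bc xc [->|->]]]]]]; first exact: path_torsion bx bc xc.
(* If the Dirichlet vertex is the last one, the path is read backwards. *)
have bij_rev m : bijective (@rev_ord m) by exists (@rev_ord m); exact: rev_ordK.
have := @path_torsion n (x \o @rev_ord _) (c \o @rev_ord _)
  (bij_comp bx (bij_rev _)) (bij_comp bc (bij_rev _)).
have -> : (x \o @rev_ord _) ord0 = x ord_max.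
  by congr x; apply: val_inj; rewrite /= subSS subn0.
apply=> i; have [b [h1 h2]] := xc (rev_ord i).
exists (~~ b); rewrite negbK /= h1 h2.
split; congr x; apply: val_inj; rewrite /= ?lift0 /=.
  by rewrite subSS [RHS]subSn // -ltnS.
by rewrite !subSS.
Qed.

End IntervalTorsion.

(** * From integrals of torsion functions to the rigidity *)

Section Rigidity.
Context {R : realType} (G : metric_graph R) (VD : {set vertex G}) (p q : R).
Hypotheses (p1 : 1 < p) (qE : q = p / (p - 1)).

Lemma p_torsional_rigidityE w : is_p_torsion_function VD p w ->
  p_torsional_rigidity VD p = graph_integral w `^ (p - 1).
Proof.
move=> wt; rewrite /p_torsional_rigidity; congr (_ `^ _).
apply: (graph_integral_torsion_unique p1 qE) (wt).
exact: (xgetPex _ (ex_intro _ w wt)).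
Qed.

(** This covers the case without a torsion function, so that existence has to be shown on intervals
    only. *)
Lemma p_torsional_rigidity_default :
  ~ (exists w, is_p_torsion_function VD p w) -> p_torsional_rigidity VD p = 0.
Proof.
move=> nex; rewrite /p_torsional_rigidity /p_torsion_function.
rewrite xgetPN; last by move=> w wt; apply: nex; exists w.
rewrite /graph_integral big1 ?powR0 // ?gt_eqF ?subr_gt0 // => e _.
by rewrite /Rintegral integral0.
Qed.

Lemma interval_p_torsional_rigidity L : 0 <= L ->
  is_interval_single_dirichlet VD L ->
  p_torsional_rigidity VD p = (L `^ (q + 1) / (q + 1)) `^ (p - 1).
Proof.
move=> L0 /(interval_torsion p1 qE)[w wt wE].
have q0 : 0 < q := lt_trans ltr01 (conjugate_gt1 p1 qE).
by rewrite (p_torsional_rigidityE wt) wE powR_primitive_ge0E.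
Qed.

End Rigidity.

Lemma interval_graph_single_dirichlet (R : realType) (L : R) (L_gt0 : 0 < L) :
  @is_interval_single_dirichlet R (interval_graph L_gt0) (finset.set1 true) L.
Proof.
split; first by rewrite /total_length big_const card_unit /= addr0.
(* The listing starts at the Dirichlet vertex [true], hence the test [i == ord0]. *)
have x_bij : bijective (fun i : 'I_2 => i == ord0).
  exists (fun b => if b then ord0 else ord_max) => [i|[]] //.
  case: eqP => [->//|]; case: i => [[|[|]]] // ? h; apply: val_inj => //.
  by case: h; exact: val_inj.
have c_bij : bijective (fun _ : 'I_1 => tt).
  by exists (fun _ => ord0) => [i|[]] //; rewrite [RHS]ord1.
exists 0%N, (fun i => i == ord0), (fun _ => tt); split => //; last first.
  by left; rewrite eqxx.
by move=> i; exists true; rewrite ord1.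
Qed.

Local Close Scope classical_set_scope.

Theorem theorem4p2 (R : realType) (G : metric_graph R) (VD : {set vertex G})
    (L p q : R) :
  graph_connected G ->
  total_length G = L ->
  VD != finset.set0 ->
  (forall v, v \in VD -> degree v = 1%N) ->
  1 < p ->
  q = p / (p - 1) ->
  [/\ p_torsional_rigidity VD p <= (L `^ (q + 1) / (q + 1)) `^ (p - 1),
      exists L_gt0 : 0 < L,
        (L `^ (q + 1) / (q + 1)) `^ (p - 1) =
        @p_torsional_rigidity R (interval_graph L_gt0) (finset.set1 true) p
    & p_torsional_rigidity VD p = (L `^ (q + 1) / (q + 1)) `^ (p - 1) <->
      is_interval_single_dirichlet VD L].
Proof.
move=> conn LE VD0 deg1 p1 qE.
have q0 : 0 < q := lt_trans ltr01 (conjugate_gt1 p1 qE).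
have p10 : 0 < p - 1 by rewrite subr_gt0.
(* A Dirichlet vertex has degree one, so there is at least one edge. *)
have L0 : 0 < L.
  have /set0Pn[v /deg1 dv] := VD0.
  have /card_gt0P[[e b] _] : (0 < #|edge_ends v|)%N by rewrite -/(degree v) dv.
  rewrite -LE /total_length (bigD1 e) //= ltr_pwDl ?elen_gt0 // sumr_ge0 //.
  move=> e' _; exact/ltW/elen_gt0.
set B := L `^ (q + 1) / (q + 1).
have BE : B = powR_primitive q (total_length G).
  by rewrite LE powR_primitive_ge0E // ltW.
have B0 : 0 < B by rewrite divr_gt0 ?powR_gt0 // addr_gt0.
split.
- have [[w wt]|/p_torsional_rigidity_default->//] :=
    pselect (exists w, is_p_torsion_function VD p w); last exact: powR_ge0.
  rewrite (p_torsional_rigidityE p1 qE wt).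
  rewrite ge0_ler_powR ?nnegrE ?(ltW p10) ?(ltW B0) //.
    exact: (graph_integral_torsion_ge0 p1 qE wt).
  by rewrite BE; exact: (graph_integral_torsion_le p1 qE conn VD0 wt).
- exists L0; symmetry; apply: (interval_p_torsional_rigidity p1 qE (ltW L0)).
  exact: interval_graph_single_dirichlet.
split; last exact: (interval_p_torsional_rigidity p1 qE (ltW L0)).
(* Without a torsion function the rigidity is 0, which cannot equal the positive bound. *)
have [[w wt]|/(p_torsional_rigidity_default p1) ->] :=
    pselect (exists w, is_p_torsion_function VD p w); last first.
  by move/eqP; rewrite lt_eqF // powR_gt0.
rewrite (p_torsional_rigidityE p1 qE wt) => /(powR_injective p10).
rewrite !nnegrE (ltW B0) (graph_integral_torsion_ge0 p1 qE wt) BE.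
move=> /(_ isT isT) wE.
rewrite -LE; apply: (graph_integral_torsion_eq p1 qE conn VD0 wt _ wE).
by rewrite LE.
Qed.
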